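(* Let $(G,\mathfrak{B})$ be a Rota-Baxter Lie group with identity $e$. Let $\mathfrak{g}=T_eG$ be the Lie algebra of $G$ and let $B=\mathfrak{B}_{*e}:\mathfrak{g}\to\mathfrak{g}$ be the tangent map of $\mathfrak{B}$ at $e$. Then $(\mathfrak{g},B)$ is a Rota-Baxter Lie algebra of weight $1$.
   Context: For a group $G$ and $g,h\in G$, $\mathrm{Ad}_g h:=ghg^{-1}$. A Rota-Baxter Lie group is a Lie group $G$ with a Rota-Baxter operator on it, i.e. a smooth map $\mathfrak{B}:G\to G$ such that $\mathfrak{B}(g_1)\mathfrak{B}(g_2)=\mathfrak{B}(g_1\,\mathrm{Ad}_{\mathfrak{B}(g_1)}g_2)$ for all $g_1,g_2\in G$ (it follows that $\mathfrak{B}(e)=e$, so $\mathfrak{B}_{*e}$ maps $\mathfrak{g}$ to $\mathfrak{g}$). A Rota-Baxter Lie algebra of weight $\lambda$ is a Lie algebra $(\mathfrak{g},[\cdot,\cdot]_{\mathfrak{g}})$ with a linear map $B:\mathfrak{g}\to\mathfrak{g}$ satisfying $[B(u),B(v)]_{\mathfrak{g}}=B([B(u),v]_{\mathfrak{g}})+B([u,B(v)]_{\mathfrak{g}})+\lambda B([u,v]_{\mathfrak{g}})$ for all $u,v\in\mathfrak{g}$. *)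

(* Defs.v *)
From HB Require Import structures.
From mathcomp Require Import all_boot all_order all_algebra.
From mathcomp Require Import all_classical all_reals all_analysis.

Set Implicit Arguments.
Unset Strict Implicit.
Unset Printing Implicit Defensive.

Import Order.TTheory GRing.Theory Num.Theory.
Import numFieldNormedType.Exports.

Local Open Scope classical_set_scope.
Local Open Scope ring_scope.

(* [U] is meant to be open, and [E], [F] to be finite-dimensional: then [Ck k]
   is the usual class C^k, since continuity of [x |-> 'd f x] amounts to
   continuity of [x |-> 'd f x v] for every [v]. *)
Fixpoint Ck (R : realType) (E F : normedModType R) (k : nat) (U : set E)
    (f : E -> F) : Prop :=
  match k with
  | 0 => forall x, U x -> {for x, continuous f}
  | k'.+1 => (forall x, U x -> differentiable f x) /\
             (forall v : E, Ck k' U (fun x => 'd f x v))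
  end.

Definition smooth_on (R : realType) (E F : normedModType R) (U : set E)
    (f : E -> F) : Prop := forall k, Ck k U f.

(* A homeomorphism between open subsets of [M] and [E]; [cmap] and [cinv] are
   total functions whose values outside [source] and [target] are irrelevant. *)
Record chart (M E : topologicalType) := Chart {
  source : set M;
  target : set E;
  cmap :> M -> E;
  cinv : E -> M;
  open_source : open source;
  open_target : open target;
  cmap_target : forall p, source p -> target (cmap p);
  cinv_source : forall x, target x -> source (cinv x);
  cmapK : forall p, source p -> cinv (cmap p) = p;
  cinvK : forall x, target x -> cmap (cinv x) = x;
  cmap_continuous : {within source, continuous cmap};
  cinv_continuous : {within target, continuous cinv} }.

(* [chart_at] witnesses that the atlas covers [M]; it also fixes, for every
   point [p], the chart through which tangent vectors at [p] are written. *)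
HB.mixin Record isManifold (R : realType) (n : nat) M of Topological M := {
  hausdorff_manifold : hausdorff_space M;
  second_countable_manifold : @second_countable M;
  atlas : set (chart M 'rV[R]_n);
  chart_at : M -> chart M 'rV[R]_n;
  chart_at_atlas : forall p, atlas (chart_at p);
  chart_at_source : forall p, source (chart_at p) p;
  atlas_compatible : forall phi psi, atlas phi -> atlas psi ->
    smooth_on (target phi `&` cinv phi @^-1` source psi) (psi \o cinv phi) }.

#[short(type="manifoldType")]
HB.structure Definition Manifold (R : realType) (n : nat) :=
  {M of Topological M & isManifold R n M}.

Definition smooth_map (R : realType) (m n : nat) (M : manifoldType R m)
    (N : manifoldType R n) (f : M -> N) : Prop :=
  continuous f /\
  forall (phi : chart M 'rV[R]_m) (psi : chart N 'rV[R]_n),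
    atlas phi -> atlas psi ->
    smooth_on (target phi `&` cinv phi @^-1` (f @^-1` source psi))
              (psi \o f \o cinv phi).

(* Smoothness of a map on the product manifold [M * N], whose atlas consists of
   the products of a chart of [M] and a chart of [N]. *)
Definition smooth_map2 (R : realType) (m n k : nat) (M : manifoldType R m)
    (N : manifoldType R n) (P : manifoldType R k) (f : M -> N -> P) : Prop :=
  continuous (fun z : M * N => f z.1 z.2) /\
  forall (phi : chart M 'rV[R]_m) (psi : chart N 'rV[R]_n)
         (chi : chart P 'rV[R]_k),
    atlas phi -> atlas psi -> atlas chi ->
    smooth_on [set z : 'rV[R]_m * 'rV[R]_n |
                 [/\ target phi z.1, target psi z.2
                   & source chi (f (cinv phi z.1) (cinv psi z.2))]]
              (fun z => chi (f (cinv phi z.1) (cinv psi z.2))).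

HB.mixin Record isLieGroup (R : realType) (n : nat) G
    of Manifold R n G & Group G := {
  mulg_smooth : smooth_map2 (fun g h : G => (g * h)%g);
  invg_smooth : smooth_map (fun g : G => (g^-1)%g) }.

#[short(type="lieGroupType")]
HB.structure Definition LieGroup (R : realType) (n : nat) :=
  {G of Manifold R n G & Group G & isLieGroup R n G}.

(* A tangent vector at [p] is given by its coordinates in [chart_at p]. *)
Definition tangent_space (R : realType) (n : nat) (M : manifoldType R n)
    (p : M) : normedModType R := 'rV[R]_n.

Definition tangent_map (R : realType) (m n : nat) (M : manifoldType R m)
    (N : manifoldType R n) (f : M -> N) (p : M) :
    tangent_space p -> tangent_space (f p) :=
  'd (chart_at (f p) \o f \o cinv (chart_at p)) (chart_at p p).

Definition chart_coord (R : realType) (n : nat) (M : manifoldType R n)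
    (phi : chart M 'rV[R]_n) (p : M) (v : tangent_space p) : 'rV[R]_n :=
  'd (phi \o cinv (chart_at p)) (chart_at p p) v.

Definition vector_field (R : realType) (n : nat) (M : manifoldType R n) :=
  forall p : M, tangent_space p.

Definition local_field (R : realType) (n : nat) (M : manifoldType R n)
    (phi : chart M 'rV[R]_n) (X : vector_field M) (x : 'rV[R]_n) : 'rV[R]_n :=
  chart_coord phi (X (cinv phi x)).

(* The Lie bracket of vector fields, [X, Y]^i = X^j d_j Y^i - Y^j d_j X^i,
   computed in [chart_at p]. *)
Definition field_bracket (R : realType) (n : nat) (M : manifoldType R n)
    (X Y : vector_field M) : vector_field M := fun p =>
  let x := chart_at p p in
  let X' := local_field (chart_at p) X in
  let Y' := local_field (chart_at p) Y in
  'd Y' x (X' x) - 'd X' x (Y' x).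

Definition lie_algebra (R : realType) (n : nat) (G : lieGroupType R n) :
  normedModType R := tangent_space (1%g : G).

(* The left translation by [g] maps [1] to [g * 1], so the value at [g] lies in
   [tangent_space (g * 1)], which is [tangent_space g]. *)
Definition left_invariant_field (R : realType) (n : nat)
    (G : lieGroupType R n) (u : lie_algebra G) : vector_field G :=
  fun g => tangent_map (fun h : G => (g * h)%g) (p := 1%g) u.

Definition lie_bracket (R : realType) (n : nat) (G : lieGroupType R n)
    (u v : lie_algebra G) : lie_algebra G :=
  field_bracket (left_invariant_field u) (left_invariant_field v) 1%g.

Definition Ad (G : groupType) (g h : G) : G := (g * h * g^-1)%g.

Definition rota_baxter_lie_group (R : realType) (n : nat)
    (G : lieGroupType R n) (B : G -> G) : Prop :=
  smooth_map B /\
  forall g1 g2 : G, (B g1 * B g2)%g = B (g1 * Ad (B g1) g2)%g.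

(* For a Rota-Baxter operator [B 1 = 1], so that the tangent map of [B] at [1]
   takes its values in [tangent_space (B 1) = lie_algebra G]. *)
Definition tangent_map1 (R : realType) (n : nat) (G : lieGroupType R n)
    (B : G -> G) : lie_algebra G -> lie_algebra G :=
  tangent_map B (p := 1%g).

Definition lie_algebra_axioms (R : fieldType) (g : lmodType R)
    (br : g -> g -> g) : Prop :=
  [/\ forall u, linear (br u),
      forall v, linear (br ^~ v),
      forall u, br u u = 0
    & forall u v w, br u (br v w) + br v (br w u) + br w (br u v) = 0].

Definition rota_baxter_lie_algebra (R : fieldType) (lambda : R)
    (g : lmodType R) (br : g -> g -> g) (B : g -> g) : Prop :=
  [/\ lie_algebra_axioms br,
      linear B
    & forall u v, br (B u) (B v) =
        B (br (B u) v) + B (br u (B v)) + lambda *: B (br u v)].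

(* Main.v *)
Require Import Defs.
From HB Require Import structures.
From mathcomp Require Import all_boot all_order all_algebra.
From mathcomp Require Import all_classical all_reals all_analysis.
From mathcomp Require Import ring.

Set Implicit Arguments.
Unset Strict Implicit.
Unset Printing Implicit Defensive.

Import Order.TTheory GRing.Theory Num.Theory.
Import numFieldNormedType.Exports.

Local Open Scope classical_set_scope.
Local Open Scope ring_scope.

(** In the chart at the identity, with [a] the image of the identity, the group
law becomes a smooth map [m] defined near [(a, a)], with [m (x, a) = x],
[m (a, y) = y] and [m] associative near the identity.  The left-invariant field
of [v] is, in this chart, [X_v x = D_2 m (x, a) v]; since [X_v a = v], the Lie
bracket at the identity is the commutator [A u v - A v u] of the bilinear
product [A u v = D X_v (a) u], the mixed second derivative of [m].

Jacobi identity.  Differentiating [m (x, m (y, z)) = m (m (x, y), z)] in [z] and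
then in [y] gives, for [x] near [a],
  [D X_v (x) (X_u x) = S_x (u, v) + X_(A u v) x]
where [S_x (u, v) = D_2 D_2 m (x, a) (u, v)] is symmetric.  One more derivative,
in [x] along [w], gives
  [A (A w u) v - A w (A u v) = D_w S (u, v) - D^2 X_v (a) (w, u)],
a sum of a term symmetric in [u, v] and a term symmetric in [w, u].  Both vanish
in the alternating sum of the associator of [A], and that sum is the Jacobiator
of the commutator ([commutator_lie]).

Rota-Baxter identity.  Write [b] for the operator in the chart, [beta] for its
differential at [a], and [q_v x] for the adjoint action of [b x] on [v].  The
derivative of the group identity in its second argument is
  [X_(beta v) (b x) = D b (x) (X_(q_v x) x)],
and, as [D q_v (a) u = A (beta u) v - A v (beta u)], its derivative along [u] is
  [A (beta u) (beta v) =
     D^2 b (a) (u, v) + beta (A u v + A (beta u) v - A v (beta u))].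
Exchanging [u] and [v] and subtracting removes the symmetric second derivative
of [b] and leaves the Rota-Baxter identity of weight 1
([commutator_rota_baxter]).

Two facts of calculus carry the computation: the symmetry of second derivatives
([diff_symmetric]), proved by evaluating a second difference with the mean value
theorem, and the product rule for [x |-> F x (h x)] with [F x] linear
([is_diff_linear_family]). *)

(** * Differentials of products and of families of linear maps *)

Section Calculus.
Context {R : realType}.

Lemma near_eq_is_diff (V W : normedModType R) (f g df : V -> W) (x : V) :
  (\forall y \near x, f y = g y) -> is_diff x f df -> is_diff x g df.
Proof.
move=> fg [dfx <-].
have [cdf fE] := (diff_locallyP _ _).1 dfx.
have gE : g \o shift x = cst (g x) + 'd f x +o_ 0 id.
  apply/eqaddoP => _/posnumP[e].
  have /eqaddoP /(_ e%:num) /(_ [gt0 of e%:num]) := fE.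
  have fg0 : \forall y \near (0 : V), f (y + x) = g (y + x).
    by move: fg; rewrite (near_shift 0); apply: filterS => y /=; rewrite subr0.
  rewrite -(nbhs_singleton fg); apply: filterS2 fg0 => y; rewrite /= !fctE /=.
  by move=> ->.
have dgE : 'd g x = 'd f x :> (V -> W) by exact: diff_unique.
apply: DiffDef; last exact: dgE.
apply/diff_locallyP; rewrite dgE; exact: (conj cdf gE).
Qed.

Lemma is_diff_sum (V W : normedModType R) n (f df : 'I_n -> V -> W) (x : V) :
  (forall i, is_diff x (f i) (df i)) ->
  is_diff x (fun y => \sum_i f i y) (fun y => \sum_i df i y).
Proof.
move=> fdf; rewrite -!fct_sumE.
by elim/big_ind2 : _ => // [|? ? ? ? ? ?]; [exact: is_diff_cst|exact: is_diffD].
Qed.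

Lemma scale_is_bilinear (W : normedModType R) :
  bilinear_for (GRing.Scale.Law.clone _ _ *:%R _)
    (GRing.Scale.Law.clone _ _ *:%R _) (@GRing.scale R W).
Proof.
split=> [w|k] a u v /=; first by rewrite scalerDl scalerA.
by rewrite scalerDr !scalerA mulrC.
Qed.
HB.instance Definition _ (W : normedModType R) :=
  bilinear_isBilinear.Build R R W W _ _ (@GRing.scale R W) (scale_is_bilinear W).

Lemma is_diff_scale (V W : normedModType R) (k dk : V -> R) (f df : V -> W)
    (x : V) :
  is_diff x k dk -> is_diff x f df ->
  is_diff x (fun y => k y *: f y) (fun y => k x *: df y + dk y *: f x).
Proof.
move=> kdk fdf.
have sc : continuous (fun p : R * W => p.1 *: p.2).
  by move=> p; exact: scale_continuous.
have : is_diff (k x, f x) (fun p : R * W => p.1 *: p.2)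
    (fun q => k x *: q.2 + q.1 *: f x).
  apply: DiffDef; first exact: (@differentiable_bilin _ _ _ _ (@GRing.scale R W)).
  by rewrite (@diff_bilin _ _ _ _ (@GRing.scale R W)).
by move=> /(is_diff_comp (is_diff_pair kdk fdf)).
Qed.

Lemma is_diff_coord (V : normedModType R) m n (h dh : V -> 'M[R]_(m, n))
    (x : V) i j :
  is_diff x h dh -> is_diff x (fun y => h y i j) (fun y => dh y i j).
Proof.
move=> hdh; have : is_diff (h x) (fun N : 'M[R]_(m, n) => N i j : R)
    (fun N => N i j).
  have @f : {linear 'M[R]_(m, n) -> R}.
    by exists (fun N : 'M[R]_(_, _) => N i j); do 2![eexists];
      do ?[constructor]; rewrite ?mxE// => ? *; rewrite ?mxE//; move=> ?;
      rewrite !mxE.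
  rewrite (_ : (fun _ => _) = f) //.
  apply: DiffDef; first exact/linear_differentiable/coord_continuous.
  exact/diff_lin/coord_continuous.
exact: is_diff_comp.
Qed.

(** The evaluation of a linear map is bilinear, so this is a product rule; it is
    proved by expanding [h y] in the canonical basis, which reduces it to finitely
    many products of a scalar function and a vector function. *)
Lemma is_diff_linear_family (V W : normedModType R) n (F : V -> 'rV[R]_n -> W)
    (dF : 'rV[R]_n -> V -> W) (h dh : V -> 'rV[R]_n) (x : V) :
  (forall y, linear (F y)) ->
  (forall w, is_diff x (F^~ w) (dF w)) -> is_diff x h dh ->
  is_diff x (fun y => F y (h y)) (fun v => dF (h x) v + F x (dh v)).
Proof.
move=> Flin FdF hdh.
have FE y w : F y w = \sum_i w 0 i *: F y (delta_mx 0 i).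
  pose FM := GRing.isLinear.Build _ _ _ _ _ (Flin y).
  pose FL : {linear _ -> _} := HB.pack (F y) FM.
  rewrite {1}[w]row_sum_delta -[LHS]/(FL _) linear_sum.
  by apply: eq_bigr => i _; rewrite linearZ.
have key (k dk : V -> 'rV[R]_n) : is_diff x k dk ->
    is_diff x (fun y => F y (k y))
      (fun v => \sum_i (k x 0 i *: dF (delta_mx 0 i) v +
                        dk v 0 i *: F x (delta_mx 0 i))).
  move=> kdk; under eq_fun do rewrite FE.
  apply: is_diff_sum => i.
  exact: is_diff_scale (is_diff_coord 0 i kdk) (FdF _).
apply: is_diff_eq (key _ _ hdh) _; apply/funext => v.
rewrite big_split/= [F x _]FE; congr +%R.
have [_ <-] := FdF (h x).
have [_ ->] := key (cst (h x)) _ (is_diff_cst _ _).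
by apply: eq_bigr => i _; rewrite mxE scale0r addr0.
Qed.
End Calculus.

(** * Symmetry of second derivatives *)

Section Young.
Context {R : realType}.

Lemma is_diff_is_derive (V W : normedModType R) (f df : V -> W) (x v : V) :
  is_diff x f df -> is_derive x v f (df v).
Proof.
move=> [dfx <-]; apply: DeriveDef; first exact: diff_derivable.
exact: deriveE.
Qed.

Lemma is_derive_line (V W : normedModType R) (f : V -> W) (y u : V) (t : R) :
  differentiable f (y + t *: u) ->
  is_derive t 1 (fun s => f (y + s *: u)) ('d f (y + t *: u) u).
Proof.
move=> df; have := is_diff_comp
  (is_diffD (is_diff_cst y t) (is_diff_scalel t u)) (differentiableP df).
move=> /(is_diff_is_derive (1 : R)); rewrite /= fctE /= add0r scale1r.
by [].
Qed.

(** Young's form of the argument: the mean value theorem is applied once, to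
    [t |-> f (x + h v + t u) - f (x + t u)] on [[0, h]], and the resulting
    difference of first derivatives is estimated with the differentiability of
    ['d f _ u] at the single point [x]. *)
Lemma second_difference (V : normedModType R) (f : V -> R) (x u v : V) (e : R) :
  (\forall y \near x, differentiable f y) ->
  differentiable (fun y => 'd f y u) x -> 0 < e ->
  \forall h \near 0^'+, `|f (x + h *: u + h *: v) - f (x + h *: u)
    - (f (x + h *: v) - f x) - h ^+ 2 * 'd (fun y => 'd f y u) x v| <= e * h ^+ 2.
Proof.
move=> fdiff ddiff e0; set L := 'd _ x.
pose N := `|u| + `|v| + 1.
have N0 : 0 < N by rewrite ltr_wpDl// addr_ge0.
(* Each of the two first-order expansions below is taken at an increment of norm
   at most [h * N], so they contribute an error of at most
   [2 * d * (h * N) = e * h]. *)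
pose d := e / (2 * N).
have d0 : 0 < d by rewrite divr_gt0// mulr_gt0.
have err : \forall k \near (0 : V),
    `|'d f (k + x) u - ('d f x u + L k)| <= d * `|k|.
  have [_ /eqaddoP /(_ d d0)] := (diff_locallyP _ _).1 ddiff.
  by apply: filterS => k; rewrite /= !fctE.
have fdiff0 : \forall k \near (0 : V), differentiable f (k + x).
  by move: fdiff; rewrite (near_shift 0); apply: filterS => k; rewrite /= subr0.
have [r /= r0 rP] : exists2 r : R, 0 < r & forall k : V, `|k| < r ->
    `|'d f (k + x) u - ('d f x u + L k)| <= d * `|k| /\
    differentiable f (k + x).
  have [r r0 rP] := nbhs_norm0P.1 (filterI err fdiff0).
  by exists r => // k kr; exact: rP.
clearbody L; near=> h.
have h0 : 0 < h by near: h; exact: nbhs_right_gt.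
have hr : h * N < r.
  rewrite -ltr_pdivlMr//; near: h; apply: nbhs_right_lt.
  exact: divr_gt0.
have small c w : 0 <= c <= h -> w = 0 \/ w = h *: v ->
    `|w + c *: u| <= h * N.
  move=> /andP[c0 ch] wE; rewrite (le_trans (ler_normD _ _))//.
  rewrite normrZ (ger0_norm c0) /N 2!mulrDr mulr1 ler_wpDr ?(ltW h0)//.
  rewrite addrC lerD ?ler_wpM2r//.
  by case: wE => ->; rewrite ?normr0 ?mulr_ge0 ?(ltW h0)// normrZ gtr0_norm.
have kP c w : 0 <= c <= h -> w = 0 \/ w = h *: v ->
    `|'d f (x + w + c *: u) u - ('d f x u + L (w + c *: u))| <= d * (h * N) /\
    differentiable f (x + w + c *: u).
  move=> c0h wE; have := small _ _ c0h wE => le1.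
  have [H1 H2] := rP _ (le_lt_trans le1 hr).
  have -> : x + w + c *: u = w + c *: u + x by rewrite -addrA addrC.
  by split=> //; rewrite (le_trans H1)// ler_wpM2l// ltW.
pose g t := f (x + h *: v + t *: u) - f (x + t *: u).
pose g' t := 'd f (x + h *: v + t *: u) u - 'd f (x + t *: u) u.
have gD t : t \in `[0, h]%R -> is_derive t 1 g (g' t).
  rewrite in_itv/= => t0h; apply: is_deriveB; apply: is_derive_line.
    exact: (kP _ _ t0h (or_intror erefl)).2.
  rewrite -[x in x + _]addr0; exact: (kP _ _ t0h (or_introl erefl)).2.
have gD_oo t : t \in `]0, h[%R -> is_derive t 1 g (g' t).
  move=> t0h; apply: gD; exact: subset_itv_oo_cc t0h.
have gC : {within `[0, h], continuous g}.
  apply: derivable_within_continuous => t t0h; have := gD _ t0h.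
  by case.
have [c] := MVT h0 gD_oo gC.
rewrite in_itv/= => /andP[/ltW c0 /ltW ch]; rewrite subr0 => gE.
have c0h : 0 <= c <= h by rewrite c0.
have [+ _] := kP _ _ c0h (or_intror erefl).
have [+ _] := kP _ _ c0h (or_introl erefl).
rewrite addr0 add0r.
have -> : L (h *: v + c *: u) = L (h *: v) + L (c *: u).
  exact: (raddfD L).
move=> E1 E2.
have -> : f (x + h *: u + h *: v) - f (x + h *: u) - (f (x + h *: v) - f x)
   = g' c * h by rewrite -gE /g !scale0r !addr0 (addrAC x).
have LE : L (h *: v) = h * L v by rewrite linearZ.
have -> : g' c * h - h ^+ 2 * L v = h * (g' c - L (h *: v)) by rewrite LE; ring.
rewrite normrM gtr0_norm// expr2 mulrCA ler_pM2l//.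
have -> : g' c - L (h *: v) =
    ('d f (x + h *: v + c *: u) u - ('d f x u + (L (h *: v) + L (c *: u)))) -
    ('d f (x + c *: u) u - ('d f x u + L (c *: u))) by rewrite /g'; ring.
rewrite (le_trans (ler_normB _ _))// (le_trans (lerD E2 E1))//.
have -> : d * (h * N) + d * (h * N) = e * h; last by [].
by rewrite /d; field; rewrite gt_eqF.
Unshelve. all: by end_near. Qed.

(** The second difference is symmetric in [u] and [v], so both second derivatives
    are its limit after division by [h ^+ 2]. *)
Lemma diff_symmetric_real (V : normedModType R) (f : V -> R) (x u v : V) :
  (\forall y \near x, differentiable f y) ->
  differentiable (fun y => 'd f y u) x -> differentiable (fun y => 'd f y v) x ->
  'd (fun y => 'd f y u) x v = 'd (fun y => 'd f y v) x u.
Proof.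
move=> fdiff du dv; apply/eqP; rewrite -subr_eq0 -normr_le0.
apply/ler_addgt0Pr => e e0; rewrite add0r.
have e20 : 0 < e / 2 by rewrite divr_gt0.
have Su := second_difference v fdiff du e20.
have Sv := second_difference u fdiff dv e20.
near (0 : R)^'+ => h.
have h0 : 0 < h by near: h; exact: nbhs_right_gt.
have h20 : 0 < h ^+ 2 by rewrite exprn_gt0.
rewrite -(ler_pM2l h20) -[X in X * `|_|]gtr0_norm// -normrM.
have : `|f (x + h *: v + h *: u) - f (x + h *: v) - (f (x + h *: u) - f x)
    - h ^+ 2 * 'd (fun y => 'd f y v) x u| <= e / 2 * h ^+ 2 by near: h.
have : `|f (x + h *: u + h *: v) - f (x + h *: u) - (f (x + h *: v) - f x)
    - h ^+ 2 * 'd (fun y => 'd f y u) x v| <= e / 2 * h ^+ 2 by near: h.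
set a := 'd _ x v; set b := 'd _ x u.
set D := f (x + h *: u + h *: v) - f (x + h *: u) - (f (x + h *: v) - f x).
have -> : f (x + h *: v + h *: u) - f (x + h *: v) - (f (x + h *: u) - f x) = D.
  by rewrite /D (addrAC x); ring.
move=> Da Db.
have -> : h ^+ 2 * (a - b) = (D - h ^+ 2 * b) - (D - h ^+ 2 * a) by ring.
rewrite (le_trans (ler_normB _ _))// (le_trans (lerD Db Da))//.
by rewrite -mulrDl -splitr mulrC.
Unshelve. all: by end_near. Qed.

(** Coordinatewise, since the mean value theorem needs real values. *)
Lemma diff_symmetric (V : normedModType R) n (f : V -> 'rV[R]_n) (x u v : V) :
  (\forall y \near x, differentiable f y) ->
  differentiable (fun y => 'd f y u) x -> differentiable (fun y => 'd f y v) x ->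
  'd (fun y => 'd f y u) x v = 'd (fun y => 'd f y v) x u.
Proof.
move=> fdiff du dv; apply/rowP => i.
have coordE w : \forall y \near x, 'd f y w 0 i = 'd (fun z => f z 0 i) y w.
  apply: filterS fdiff => y fy.
  by have [_ ->] := is_diff_coord 0 i (differentiableP fy).
have coordD w : differentiable (fun y => 'd f y w) x ->
    is_diff x (fun y => 'd (fun z => f z 0 i) y w)
      (fun k => 'd (fun y => 'd f y w) x k 0 i).
  by move=> dw; apply: near_eq_is_diff (coordE w) _; exact/is_diff_coord/differentiableP.
have [du' /(congr1 (@^~ v)) /= <-] := coordD _ du.
have [dv' /(congr1 (@^~ u)) /= <-] := coordD _ dv.
apply: diff_symmetric_real => //.
by apply: filterS fdiff => y fy; have [] := is_diff_coord 0 i (differentiableP fy).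
Qed.
End Young.

(** * Partial differentials and smooth maps *)

Section Slices.
Context {R : realType}.

Lemma is_diffE (V W : normedModType R) (f df : V -> W) (x v : V) :
  is_diff x f df -> 'd f x v = df v.
Proof. by move=> [_ ->]. Qed.

Lemma is_diff_ex (V W : normedModType R) (f df : V -> W) (x : V) :
  is_diff x f df -> differentiable f x.
Proof. by case. Qed.

Lemma is_diff_unique (V W : normedModType R) (f df dg : V -> W) (x v : V) :
  is_diff x f df -> is_diff x f dg -> df v = dg v.
Proof. by move=> /(is_diffE v) <- /(is_diffE v). Qed.

Lemma is_diff_slicel (U V W : normedModType R) (f : U * V -> W) x y :
  differentiable f (x, y) ->
  is_diff x (fun t => f (t, y)) (fun u => 'd f (x, y) (u, 0)).
Proof.
move=> /differentiableP df.
exact: is_diff_comp (is_diff_pair (is_diff_id x) (is_diff_cst y x)) df.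
Qed.

Lemma is_diff_slicer (U V W : normedModType R) (f : U * V -> W) x y :
  differentiable f (x, y) ->
  is_diff y (fun t => f (x, t)) (fun v => 'd f (x, y) (0, v)).
Proof.
move=> /differentiableP df.
exact: is_diff_comp (is_diff_pair (is_diff_cst x y) (is_diff_id y)) df.
Qed.

Lemma diff_inl_linear (U V W : normedModType R) (f : U * V -> W) z :
  linear (fun u : U => 'd f z (u, 0)).
Proof.
move=> k u v; rewrite -linearP; congr ('d f _ _).
by rewrite -[RHS]/(k *: u + v, k *: 0 + 0) scaler0 addr0.
Qed.

Lemma diff_inr_linear (U V W : normedModType R) (f : U * V -> W) z :
  linear (fun v : V => 'd f z (0, v)).
Proof.
move=> k u v; rewrite -linearP; congr ('d f _ _).
by rewrite -[RHS]/(k *: 0 + 0, k *: u + v) scaler0 addr0.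
Qed.

Lemma near_curry (U V : topologicalType) (P : U * V -> Prop) (p : U) (q : V) :
  (\forall z \near (p, q), P z) -> \forall x \near p, \forall y \near q, P (x, y).
Proof.
move=> [[A B] [/= Ap Bq] AB]; apply: filterS Ap => x Ax.
by apply: filterS Bq => y By; exact: (AB (x, y)).
Qed.

Lemma smooth_on_diff (V W : normedModType R) (U : set V) (f : V -> W) x :
  smooth_on U f -> U x -> differentiable f x.
Proof. by move=> /(_ 1%N)[+ _] => /[apply]. Qed.

Lemma smooth_on_derive (V W : normedModType R) (U : set V) (f : V -> W) v :
  smooth_on U f -> smooth_on U (fun x => 'd f x v).
Proof. move=> sf k; exact: (sf k.+1).2. Qed.

Lemma smooth_on_symmetric (V : normedModType R) n (U : set V)
    (f : V -> 'rV[R]_n) x u v : open U -> smooth_on U f -> U x ->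
  'd (fun y => 'd f y u) x v = 'd (fun y => 'd f y v) x u.
Proof.
move=> oU sf Ux; apply: diff_symmetric.
- by apply: filterS (open_nbhs_nbhs (conj oU Ux)) => y; exact: smooth_on_diff.
- exact: (smooth_on_diff (smooth_on_derive u sf)).
- exact: (smooth_on_diff (smooth_on_derive v sf)).
Qed.
End Slices.

(** The algebraic core of the Jacobi identity.  An associator that is the sum of
    a part symmetric in its last two arguments and a part symmetric in its first
    two has zero alternating sum, hence [A] is Lie-admissible. *)
Lemma commutator_lie (R : fieldType) (n : nat)
    (A : 'rV[R]_n -> 'rV[R]_n -> 'rV[R]_n)
    (S H : 'rV[R]_n -> 'rV[R]_n -> 'rV[R]_n -> 'rV[R]_n) :
  (forall v, linear (A^~ v)) -> (forall u, linear (A u)) ->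
  (forall w u v, S w u v = S w v u) -> (forall w u v, H w u v = H u w v) ->
  (forall u v w, A (A w u) v = A w (A u v) + S w u v - H w u v) ->
  lie_algebra_axioms (fun u v => A u v - A v u).
Proof.
move=> Al Ar SC HC assocA; split.
- by move=> u k v w; rewrite Al Ar scalerBr opprD addrACA.
- by move=> v k u w; rewrite Al Ar scalerBr opprD addrACA.
- by move=> u; rewrite subrr.
move=> u v w.
have AB x y z : A x (y - z) = A x y - A x z.
  by rewrite addrC -scaleN1r Ar scaleN1r addrC.
have BA x y z : A (y - z) x = A y x - A z x.
  by rewrite addrC -scaleN1r Al scaleN1r addrC.
rewrite !AB !BA !assocA (SC u w) (SC v u) (SC w v) (HC w u) (HC u v) (HC v w).
by apply/rowP => i; rewrite !mxE; ring.
Qed.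

(** The algebraic core of the Rota-Baxter identity: antisymmetrizing the second
    order relation cancels the symmetric term [D]. *)
Lemma commutator_rota_baxter (R : fieldType) (n : nat)
    (A D : 'rV[R]_n -> 'rV[R]_n -> 'rV[R]_n) (f : {linear 'rV[R]_n -> 'rV[R]_n}) :
  (forall u v, D u v = D v u) ->
  (forall u v, A (f u) (f v) = D u v + f (A u v + (A (f u) v - A v (f u)))) ->
  forall u v, A (f u) (f v) - A (f v) (f u) =
    f (A (f u) v - A v (f u)) + f (A u (f v) - A (f v) u) + f (A u v - A v u).
Proof.
move=> DC AfE u v; rewrite !AfE (DC v u) opprD addrACA subrr add0r.
rewrite -raddfB -!raddfD; congr (f _).
by apply/rowP => j; rewrite !mxE; ring.
Qed.

(** * Local groups and their bracket *)

Section LocalGroup.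
Context {R : realType} {n : nat}.
Local Notation E := 'rV[R]_n.

(** The identities are only required near the unit because the product of two
    points of a chart need not stay in the chart. *)
Record local_group (m : E * E -> E) (a : E) (W : set (E * E)) : Prop := {
  lg_open : open W;
  lg_dom : W (a, a);
  lg_smooth : smooth_on W m;
  lg_unitl : \forall y \near a, m (a, y) = y;
  lg_unitr : \forall x \near a, m (x, a) = x;
  lg_assoc : \forall t \near ((a, a), a),
    m (t.1.1, m (t.1.2, t.2)) = m (m (t.1.1, t.1.2), t.2) }.

Context (m : E * E -> E) (a : E) (W : set (E * E)) (mG : local_group m a W).

(** The local expression of the left-invariant vector field of [v]. *)
Definition left_field (v x : E) : E := 'd m (x, a) (0, v).
(** The mixed term of the Taylor expansion of the product at the unit: the
    second derivative of [m] at [(a, a)] along [(u, 0)] and [(0, v)]. *)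
Definition second_product (u v : E) : E := 'd (left_field v) a u.
Local Notation A := second_product.

Let W_nbhs : \forall z \near (a, a), W z.
Proof. exact: open_nbhs_nbhs (conj (lg_open mG) (lg_dom mG)). Qed.

Let W_nearl : \forall x \near a, W (x, a).
Proof. by apply: filterS (near_curry W_nbhs) => x; exact: nbhs_singleton. Qed.

Let m_diff z : W z -> differentiable m z.
Proof. exact: smooth_on_diff (lg_smooth mG). Qed.

Let dm_diff v z : W z -> differentiable (fun y => 'd m y v) z.
Proof. exact: smooth_on_diff (smooth_on_derive v (lg_smooth mG)). Qed.

Let d2m_diff v w z : W z -> differentiable (fun y => 'd (fun t => 'd m t v) y w) z.
Proof.
exact: smooth_on_diff (smooth_on_derive w (smooth_on_derive v (lg_smooth mG))).
Qed.

Let maa : m (a, a) = a.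
Proof. exact: nbhs_singleton (lg_unitl mG). Qed.

Lemma left_field_unit v : left_field v a = v.
Proof.
apply: is_diff_unique (is_diff_slicer (m_diff (lg_dom mG))) _.
apply: near_eq_is_diff (is_diff_id a).
by apply: filterS (lg_unitl mG) => y /= ->.
Qed.

Lemma diff_mul_unitr v : 'd m (a, a) (v, 0) = v.
Proof.
apply: is_diff_unique (is_diff_slicel (m_diff (lg_dom mG))) _.
apply: near_eq_is_diff (is_diff_id a).
by apply: filterS (lg_unitr mG) => y /= ->.
Qed.

Lemma left_field_linear x : linear (left_field^~ x).
Proof.
exact: diff_inr_linear.
Qed.

Lemma left_field_is_diff v x : W (x, a) ->
  is_diff x (left_field v) (fun u => 'd (fun z => 'd m z (0, v)) (x, a) (u, 0)).
Proof. by move=> /dm_diff Wx; exact: is_diff_slicel. Qed.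

(** Left invariance: associativity [m (x, m (y, t)) = m (m (x, y), t)]
    differentiated in [t] at the unit. *)
Lemma left_field_mul v :
  \forall z \near (a, a), 'd m z (0, left_field v z.2) = left_field v (m z).
Proof.
have m_cont : m @ (a, a) --> m (a, a).
  exact: differentiable_continuous (m_diff (lg_dom mG)).
rewrite maa in m_cont.
have Wm : \forall z \near (a, a), W (m z, a) := m_cont _ W_nearl.
have Wr : \forall z \near (a, a), W (z.2, a) /\ m (z.2, a) = z.2.
  by apply: (cvg_snd (filterI W_nearl (lg_unitr mG))).
have assoc := near_curry (lg_assoc mG).
near=> z.
have Wz : W (z.1, z.2) by rewrite -surjective_pairing; near: z.
have [Wz2 mz2] : W (z.2, a) /\ m (z.2, a) = z.2 by near: z.
have Wmz : W (m z, a) by near: z.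
have az : \forall y \near a, m (z.1, m (z.2, y)) = m (m z, y).
  have : \forall y \near a, m (z.1, m (z.2, y)) = m (m (z.1, z.2), y) by near: z.
  by rewrite -surjective_pairing.
have outer : is_diff (m (z.2, a)) (fun t => m (z.1, t)) (fun u => 'd m z (0, u)).
  by rewrite mz2; have := is_diff_slicer (m_diff Wz); rewrite -surjective_pairing.
have inner := is_diff_slicer (m_diff Wz2).
have lhs := near_eq_is_diff az (is_diff_comp inner outer).
exact: is_diff_unique v lhs (is_diff_slicer (m_diff Wmz)).
Unshelve. all: by end_near. Qed.

Let left_field_diff v : differentiable (left_field v) a.
Proof. exact: is_diff_ex (left_field_is_diff v (lg_dom mG)). Qed.

Let left_field_diff2 v w : differentiable (fun x => 'd (left_field v) x w) a.
Proof.
have sl := is_diff_slicel (d2m_diff (0, v) (w, 0) (lg_dom mG)).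
apply: is_diff_ex (near_eq_is_diff _ sl).
apply: filterS W_nearl => x Wx.
exact: esym (is_diffE w (left_field_is_diff v Wx)).
Qed.

(** Left invariance differentiated once more, in the second argument of [m]; the
    first term on the right is symmetric in [u] and [v]. *)
Lemma left_field_derive u v : \forall x \near a,
  'd (left_field v) x (left_field u x) =
  'd (fun z => 'd m z (0, v)) (x, a) (0, u) + left_field (A u v) x.
Proof.
have mulE := near_curry (left_field_mul v).
near=> x.
have Wx : W (x, a) by near: x.
have mx : m (x, a) = x by near: x; exact: (lg_unitr mG).
have mulEx : \forall y \near a,
    'd m (x, y) (0, left_field v y) = left_field v (m (x, y)) by near: x.
have slice w := is_diff_slicer (dm_diff (0, w) Wx).
have := is_diff_linear_family (fun y => diff_inr_linear m (x, y)) slice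
  (differentiableP (left_field_diff v)).
rewrite left_field_unit => lhs.
have outer : is_diff (m (x, a)) (left_field v) ('d (left_field v) x).
  by rewrite mx; exact: differentiableP (is_diff_ex (left_field_is_diff v Wx)).
have rhs := is_diff_comp (is_diff_slicer (m_diff Wx)) outer.
exact: esym (is_diff_unique u (near_eq_is_diff mulEx lhs) rhs).
Unshelve. all: by end_near. Qed.

(** The derivative along [w] of the symmetric term of [left_field_derive]. *)
Definition third_left (w u v : E) : E :=
  'd (fun z => 'd (fun y => 'd m y (0, v)) z (0, u)) (a, a) (w, 0).

Definition third_mixed (w u v : E) : E := 'd (fun x => 'd (left_field v) x u) a w.

Lemma third_leftC w u v : third_left w u v = third_left w v u.
Proof.
have d2 := differentiableP (d2m_diff (0, u) (0, v) (lg_dom mG)).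
apply: is_diffE (near_eq_is_diff _ d2).
apply: filterS W_nbhs => z Wz.
exact: (smooth_on_symmetric _ _ (lg_open mG) (lg_smooth mG) Wz).
Qed.

Lemma third_mixedC w u v : third_mixed w u v = third_mixed u w v.
Proof.
apply: diff_symmetric => //.
by apply: filterS W_nearl => x /(left_field_is_diff v) /is_diff_ex.
Qed.

(** Both sides come from differentiating [left_field_derive] at the unit along
    [w]. *)
Lemma second_product_associator u v w :
  A (A w u) v = A w (A u v) + third_left w u v - third_mixed w u v.
Proof.
have := is_diff_linear_family (fun x => linearP ('d (left_field v) x))
  (fun t => differentiableP (left_field_diff2 v t))
  (differentiableP (left_field_diff u)).
rewrite left_field_unit => lhs.
have rhs := is_diffD (is_diff_slicel (d2m_diff (0, v) (0, u) (lg_dom mG)))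
  (differentiableP (left_field_diff (A u v))).
have : third_mixed w u v + A (A w u) v = third_left w u v + A w (A u v).
  exact: is_diff_unique w (near_eq_is_diff (left_field_derive u v) lhs) rhs.
move=> /(canRL (addKr _)) ->.
by rewrite addrC [X in X - _]addrC.
Qed.

Lemma second_product_linearl v : linear (A^~ v).
Proof. exact: linearP. Qed.

Lemma second_product_linearr u : linear (A u).
Proof.
move=> k v w.
have dv := differentiableP (left_field_diff v).
have dw := differentiableP (left_field_diff w).
apply: (is_diffE u (near_eq_is_diff _ (is_diffD (is_diffZ k dv) dw))).
by apply: filterE => x; rewrite left_field_linear.
Qed.

Definition local_bracket (u v : E) : E := A u v - A v u.

Lemma local_bracket_lie : lie_algebra_axioms local_bracket.
Proof.
exact: (commutator_lie second_product_linearl second_product_linearr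
  third_leftC third_mixedC second_product_associator).
Qed.

(** Differentiate [m (x, i x) = a], knowing both partial differentials of [m]. *)
Lemma diff_inverse (i : E -> E) (w : E) : differentiable i a -> i a = a ->
  (\forall x \near a, m (x, i x) = a) -> 'd i a w = - w.
Proof.
move=> /differentiableP di ia mi.
have dm : is_diff (a, i a) m ('d m (a, a)).
  by rewrite ia; exact: differentiableP (m_diff (lg_dom mG)).
have mi' : \forall x \near a, a = m (x, i x) by apply: filterS mi => x ->.
have E0 : 0 = 'd m (a, a) (w, 'd i a w).
  exact: is_diff_unique w (near_eq_is_diff mi' (is_diff_cst a a))
    (is_diff_comp (is_diff_pair (is_diff_id a) di) dm).
have E1 : (w, 'd i a w) = (w, 0) + (0, 'd i a w).
  by rewrite -[RHS]/(w + 0, 0 + _) addr0 add0r.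
move: E0; rewrite E1 raddfD/= diff_mul_unitr.
rewrite -[X in _ + X]/(left_field ('d i a w) a) left_field_unit => /esym/eqP.
by rewrite addrC addr_eq0 => /eqP.
Qed.

(** The part along [(w, 0)] vanishes, as [m (_, a)] is the identity; the part
    along [(0, w)] is [A v w] by symmetry of second derivatives.  The direction
    [(w, - w)] is that of the curve [x |-> (x, i x)]. *)
Lemma diff2_mul_antidiagonal (v w : E) :
  'd (fun z => 'd m z (v, 0)) (a, a) (w, - w) = - A v w.
Proof.
have pairE : (w, - w) = (w, 0) - (0, w) :> E * E.
  by rewrite -[RHS]/(w - 0, 0 - w) subr0 sub0r.
have dl : 'd (fun z => 'd m z (v, 0)) (a, a) (w, 0) = 0.
  have cstE : \forall x \near a, v = 'd m (x, a) (v, 0).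
    have unitE : \forall x \near a, \forall y \near x, m (y, a) = y.
      exact: nbhs_interior (lg_unitr mG).
    apply: filterS2 W_nearl unitE => x Wx mE.
    have mE' : \forall y \near x, y = m (y, a) by apply: filterS mE => y /= ->.
    exact: is_diff_unique v (near_eq_is_diff mE' (is_diff_id x))
      (is_diff_slicel (m_diff Wx)).
  exact: is_diff_unique w (is_diff_slicel (dm_diff (v, 0) (lg_dom mG)))
    (near_eq_is_diff cstE (is_diff_cst v a)).
have dr : 'd (fun z => 'd m z (v, 0)) (a, a) (0, w) = A v w.
  rewrite (smooth_on_symmetric _ _ (lg_open mG) (lg_smooth mG) (lg_dom mG)).
  exact: esym (is_diffE v (left_field_is_diff w (lg_dom mG))).
rewrite pairE raddfB/=.
by apply: (eq_trans (congr2 (fun x y => x - y) dl dr)); exact: sub0r.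
Qed.

Section RotaBaxter.
Context (b i : E -> E) (U : set E).
Context (oU : open U) (Ua : U a) (b_smooth : smooth_on U b) (ba : b a = a).
Context (i_diff : differentiable i a) (ia : i a = a)
  (mi : \forall x \near a, m (x, i x) = a).
Context (rota_baxter : \forall z \near (a, a),
  m (b z.1, b z.2) = b (m (z.1, m (m (b z.1, z.2), i (b z.1))))).

Local Notation beta := ('d b a).

(** The derivative at the unit of [y |-> (b x * y) * (b x)^-1], that is the
    adjoint action of [b x] on [v]. *)
Definition adjoint_field (v x : E) : E :=
  'd m (b x, i (b x)) (left_field v (b x), 0).

Let b_diff x : U x -> is_diff x b ('d b x).
Proof. by move=> Ux; exact: differentiableP (smooth_on_diff b_smooth Ux). Qed.

Let b_cvg : b @ a --> a.
Proof. by rewrite -{2}ba; exact: differentiable_continuous (is_diff_ex (b_diff Ua)). Qed.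

Lemma adjoint_field_unit v : adjoint_field v a = v.
Proof. by rewrite /adjoint_field ba ia left_field_unit diff_mul_unitr. Qed.

(** The derivative of the adjoint action is the bracket, here precomposed with
    the differential of [b]. *)
Lemma adjoint_field_is_diff v :
  is_diff a (adjoint_field v) (fun u => A (beta u) v - A v (beta u)).
Proof.
have db := b_diff Ua.
have dib : is_diff (b a) i (-%R).
  rewrite ba; apply: is_diff_eq (differentiableP i_diff) _.
  by apply/funext => w; exact: diff_inverse.
have dz := is_diff_pair db (is_diff_comp db dib).
have dF w : is_diff a (fun x => 'd m (b x, i (b x)) (w, 0))
    (fun u => 'd (fun z => 'd m z (w, 0)) (a, a) (beta u, - beta u)).
  have dD : is_diff (b a, (i \o b) a) (fun z => 'd m z (w, 0))
      ('d (fun z => 'd m z (w, 0)) (a, a)).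
    by rewrite /= ba ia; exact: differentiableP (dm_diff (w, 0) (lg_dom mG)).
  exact: is_diff_comp dz dD.
have dh : is_diff a (left_field v \o b) (fun u => A (beta u) v).
  have dv : is_diff (b a) (left_field v) ('d (left_field v) a).
    by rewrite ba; exact: differentiableP.
  exact: is_diff_comp db dv.
have := is_diff_linear_family (fun x => diff_inl_linear m (b x, i (b x))) dF dh.
have -> : (left_field v \o b) a = v by rewrite /= ba left_field_unit.
move=> dq; apply: is_diff_eq dq _; apply/funext => u.
have dl : 'd m (b a, i (b a)) (A (beta u) v, 0) = A (beta u) v.
  by rewrite ba ia; exact: diff_mul_unitr.
rewrite [RHS]addrC.
exact: (congr2 +%R (diff2_mul_antidiagonal v (beta u)) dl).
Qed.

(** The Rota-Baxter identity differentiated in its second argument. *)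
Lemma rota_baxter_first_order v : \forall x \near a,
  left_field (beta v) (b x) = 'd b x (left_field (adjoint_field v x) x).
Proof.
have W_pair : \forall x \near a, W (x, i x).
  have : (fun x => (x, i x)) @ a --> (a, a).
    have dp := is_diff_pair (is_diff_id a) (differentiableP i_diff).
    by rewrite -{3}ia; exact: differentiable_continuous (is_diff_ex dp).
  by move=> /(_ _ W_nbhs).
have aW : \forall x \near a,
    [/\ W (x, a), W (x, i x), m (x, a) = x & m (x, i x) = a].
  by near=> x; split; near: x => //; exact: (lg_unitr mG).
have bW : \forall x \near a,
    [/\ W (b x, a), W (b x, i (b x)), m (b x, a) = b x & m (b x, i (b x)) = a].
  exact: b_cvg _ aW.
have rbE := near_curry rota_baxter.
near=> x.
have Wx : W (x, a) by near: x.
have mx : m (x, a) = x by near: x; exact: (lg_unitr mG).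
have Ux : U x by near: x; exact: open_nbhs_nbhs.
have [Wbx Wbix mbx mbix] : [/\ W (b x, a), W (b x, i (b x)), m (b x, a) = b x
  & m (b x, i (b x)) = a] by near: x.
have rbx : \forall y \near a,
  m (b x, b y) = b (m (x, m (m (b x, y), i (b x)))) by near: x.
have d0 : is_diff (b a) (fun y => m (b x, y)) (left_field^~ (b x)).
  by rewrite ba; exact: is_diff_slicer (m_diff Wbx).
have d1 := is_diff_slicer (m_diff Wbx).
have d2 : is_diff (m (b x, a)) (fun t => m (t, i (b x)))
    (fun w => 'd m (b x, i (b x)) (w, 0)).
  by rewrite mbx; exact: is_diff_slicel (m_diff Wbix).
have d3 : is_diff (m (m (b x, a), i (b x))) (fun t => m (x, t)) (left_field^~ x).
  by rewrite mbx mbix; exact: is_diff_slicer (m_diff Wx).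
have d4 : is_diff (m (x, m (m (b x, a), i (b x)))) b ('d b x).
  by rewrite mbx mbix mx; exact: b_diff.
exact: is_diff_unique v (near_eq_is_diff rbx (is_diff_comp (b_diff Ua) d0))
  (is_diff_comp (is_diff_comp (is_diff_comp d1 d2) d3) d4).
Unshelve. all: by end_near. Qed.

(** [rota_baxter_first_order] differentiated at the unit along [u]. *)
Lemma rota_baxter_second_order u v :
  A (beta u) (beta v) = 'd (fun x => 'd b x v) a u +
    beta (A u v + (A (beta u) v - A v (beta u))).
Proof.
have dlhs : is_diff a (left_field (beta v) \o b) (fun u => A (beta u) (beta v)).
  have dv : is_diff (b a) (left_field (beta v)) ('d (left_field (beta v)) a).
    by rewrite ba; exact: differentiableP.
  exact: is_diff_comp (b_diff Ua) dv.
have := is_diff_linear_family left_field_linear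
  (fun w => differentiableP (left_field_diff w)) (adjoint_field_is_diff v).
rewrite adjoint_field_unit => dh.
have d2b w : differentiable (fun x => 'd b x w) a.
  exact: smooth_on_diff (smooth_on_derive w b_smooth) Ua.
have := is_diff_linear_family (fun x => linearP ('d b x))
  (fun w => differentiableP (d2b w)) dh.
rewrite adjoint_field_unit left_field_unit => drhs.
have := is_diff_unique u (near_eq_is_diff (rota_baxter_first_order v) dlhs) drhs.
by rewrite /= left_field_unit.
Qed.

Lemma local_bracket_rota_baxter u v :
  local_bracket (beta u) (beta v) = beta (local_bracket (beta u) v) +
    beta (local_bracket u (beta v)) + beta (local_bracket u v).
Proof.
have D2C x y : 'd (fun z => 'd b z y) a x = 'd (fun z => 'd b z x) a y.
  exact: smooth_on_symmetric oU b_smooth Ua.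
exact: (commutator_rota_baxter D2C rota_baxter_second_order).
Qed.
End RotaBaxter.
End LocalGroup.

(** * The local group of a Lie group *)

Section Charts.
Context {R : realType} {n : nat}.

Lemma cinv_cvg (M : topologicalType) (phi : chart M 'rV[R]_n) x :
  target phi x -> cinv phi @ x --> cinv phi x.
Proof.
move=> tx; have := @cinv_continuous _ _ phi.
by rewrite continuous_open_subspace; [apply; rewrite inE|exact: open_target].
Qed.

Lemma target_nbhs (M : topologicalType) (phi : chart M 'rV[R]_n) x :
  target phi x -> \forall y \near x, target phi y.
Proof. by move=> tx; exact: open_nbhs_nbhs (conj (open_target phi) tx). Qed.

Lemma source_nbhs (M : topologicalType) (phi : chart M 'rV[R]_n) p :
  source phi p -> \forall q \near p, source phi q.
Proof. by move=> sp; exact: open_nbhs_nbhs (conj (open_source phi) sp). Qed.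

End Charts.

Section LieGroupLocal.
Context {R : realType} {n : nat} (G : lieGroupType R n).
Local Notation phi := (chart_at (1%g : G)).
Local Notation e0 := (phi 1%g).
Local Notation tau := (cinv phi).

Definition local_mul (z : 'rV[R]_n * 'rV[R]_n) : 'rV[R]_n :=
  phi (tau z.1 * tau z.2)%g.

Definition local_mul_dom : set ('rV[R]_n * 'rV[R]_n) :=
  [set z | [/\ target phi z.1, target phi z.2
             & source phi (tau z.1 * tau z.2)%g]].

Lemma mulg_cvg (T : Type) (F : set_system T) {FF : Filter F} (f g : T -> G) p q :
  f @ F --> p -> g @ F --> q -> (f x * g x)%g @[x --> F] --> (p * q)%g.
Proof.
move=> fp gq; have [mc _] := @mulg_smooth R n G.
exact: (cvg_comp _ _ (cvg_pair fp gq) (mc (p, q))).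
Qed.

Lemma invg_cvg (T : Type) (F : set_system T) {FF : Filter F} (f : T -> G) p :
  f @ F --> p -> (f x)^-1%g @[x --> F] --> (p^-1)%g.
Proof.
move=> fp; have [ic _] := @invg_smooth R n G.
exact: (cvg_comp _ _ fp (ic p)).
Qed.

Let s1 : source phi 1%g.
Proof. exact: chart_at_source. Qed.

Let te : target phi e0.
Proof. exact: cmap_target. Qed.

Let tau_e : tau e0 = 1%g.
Proof. exact: cmapK. Qed.

Let tau_cvg : tau @ e0 --> (1%g : G).
Proof. by rewrite -[X in _ --> X]tau_e; exact: cinv_cvg. Qed.

Lemma local_mul_dom_open : open local_mul_dom.
Proof.
rewrite openE => z [t1 t2 s12]; rewrite /interior /=.
have c1 : tau z'.1 @[z' --> z] --> tau z.1.
  exact: (cvg_comp _ _ cvg_fst (cinv_cvg t1)).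
have c2 : tau z'.2 @[z' --> z] --> tau z.2.
  exact: (cvg_comp _ _ cvg_snd (cinv_cvg t2)).
have c12 := mulg_cvg c1 c2.
near=> y; split.
- by near: y; apply: (cvg_fst (target_nbhs t1)).
- by near: y; apply: (cvg_snd (target_nbhs t2)).
- by near: y; exact: c12 _ (source_nbhs s12).
Unshelve. all: by end_near. Qed.

Lemma local_mul_group : local_group local_mul e0 local_mul_dom.
Proof.
have near_t : \forall x \near e0, target phi x by exact: target_nbhs.
have near_s : \forall g \near (1%g : G), source phi g by exact: source_nbhs.
have [_ mul_smooth] := @mulg_smooth R n G.
split.
- exact: local_mul_dom_open.
- by split; rewrite //= tau_e mul1g.
- by apply: mul_smooth; exact: chart_at_atlas.
- by apply: filterS near_t => y ty; rewrite /local_mul /= tau_e mul1g cinvK.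
- by apply: filterS near_t => y ty; rewrite /local_mul /= tau_e mulg1 cinvK.
have c1 : tau t.1.1 @[t --> ((e0, e0), e0)] --> (1%g : G).
  exact: (cvg_comp _ _ cvg_fst (cvg_comp _ _ cvg_fst tau_cvg)).
have c2 : tau t.1.2 @[t --> ((e0, e0), e0)] --> (1%g : G).
  exact: (cvg_comp _ _ cvg_fst (cvg_comp _ _ cvg_snd tau_cvg)).
have c3 : tau t.2 @[t --> ((e0, e0), e0)] --> (1%g : G).
  exact: (cvg_comp _ _ cvg_snd tau_cvg).
have c12 := mulg_cvg c1 c2; rewrite mul1g in c12.
have c23 := mulg_cvg c2 c3; rewrite mul1g in c23.
near=> t; rewrite /local_mul /=.
rewrite !cmapK ?mulgA//; near: t; [exact: c12 _ near_s|exact: c23 _ near_s].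
Unshelve. all: by end_near. Qed.

(** The chain rule through the chart at the point: the tangent map of the left
    translation is written in that chart, and the transition map brings it back
    to the chart at the identity. *)
Lemma local_field_left_invariant (u : lie_algebra G) : \forall x \near e0,
  local_field phi (left_invariant_field u) x = left_field local_mul e0 u x.
Proof.
have [_ mul_smooth] := @mulg_smooth R n G.
near=> x.
have tx : target phi x by near: x; exact: target_nbhs.
have dom_x : local_mul_dom (x, e0).
  by split; rewrite //= tau_e mulg1; exact: cinv_source.
rewrite /local_field /chart_coord /left_invariant_field /tangent_map mulg1.
set p := tau x; set psi := chart_at p.
have sp : source psi p by exact: chart_at_source.
have pe : (p * tau e0)%g = p by rewrite tau_e mulg1.
have inner : is_diff e0 (psi \o (fun h : G => (p * h)%g) \o tau)
    ('d (psi \o (fun h : G => (p * h)%g) \o tau) e0).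
  have sm := mul_smooth phi phi psi (chart_at_atlas _) (chart_at_atlas _)
    (chart_at_atlas _).
  apply: differentiableP.
  apply: is_diff_ex (is_diff_slicer (x := x) (smooth_on_diff sm _)).
  by split; rewrite //= -/p pe.
have outer : is_diff ((psi \o (fun h : G => (p * h)%g) \o tau) e0)
    (phi \o cinv psi) ('d (phi \o cinv psi) (psi p)).
  rewrite /= pe; apply: differentiableP.
  have transition :=
    atlas_compatible _ _ (chart_at_atlas p) (chart_at_atlas (1%g : G)).
  apply: (smooth_on_diff transition).
  split; first exact: cmap_target.
  by rewrite /= cmapK//; exact: cinv_source.
have agree : \forall t \near e0,
    (phi \o cinv psi) ((psi \o (fun h : G => (p * h)%g) \o tau) t) =
    local_mul (x, t).
  have c : (p * tau t)%g @[t --> e0] --> p.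
    by have := mulg_cvg (cvg_cst p) tau_cvg; rewrite mulg1; apply.
  have sc : \forall t \near e0, source psi (p * tau t)%g.
    exact: c _ (source_nbhs sp).
  by apply: filterS sc => t st; rewrite /= cmapK.
have dm := smooth_on_diff (lg_smooth local_mul_group) dom_x.
exact: is_diff_unique u (near_eq_is_diff agree (is_diff_comp inner outer))
  (is_diff_slicer dm).
Unshelve. all: by end_near. Qed.

(** The bracket of vector fields is a difference of directional derivatives, and
    these only depend on the fields near the identity. *)
Lemma lie_bracket_local (u v : lie_algebra G) :
  lie_bracket u v = local_bracket local_mul e0 u v.
Proof.
have Xnear w := local_field_left_invariant w.
have X1 w : local_field phi (left_invariant_field w) e0 = w.
  by rewrite (nbhs_singleton (Xnear w)); exact: left_field_unit local_mul_group _.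
have dX w t s : s = t -> 'd (local_field phi (left_invariant_field w)) e0 s =
    second_product local_mul e0 t w.
  move=> ->; have dl := is_diff_ex (left_field_is_diff local_mul_group w
    (lg_dom local_mul_group)).
  apply: is_diffE (near_eq_is_diff _ (differentiableP dl)).
  by apply: filterS (Xnear w) => x ->.
have subE (x y x' y' : 'rV[R]_n) : x = x' -> y = y' -> x - y = x' - y'.
  by move=> -> ->.
exact: subE (dX v u _ (X1 u)) (dX u v _ (X1 v)).
Qed.

(** [B 1] is idempotent: take both arguments equal to [1]. *)
Lemma rota_baxter1 (B : G -> G) :
  (forall g1 g2 : G, (B g1 * B g2)%g = B (g1 * Ad (B g1) g2)%g) -> B 1%g = 1%g.
Proof.
move=> rb; have := rb 1%g 1%g; rewrite /Ad mulg1 mulgV mulg1 => /(canRL (mulKg _)).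
by rewrite mulVg.
Qed.

Section RotaBaxterOperator.
Context (B : G -> G) (hB : rota_baxter_lie_group B).

Let B1 : B 1%g = 1%g.
Proof. exact: rota_baxter1 hB.2. Qed.

Definition local_map (f : G -> G) : 'rV[R]_n -> 'rV[R]_n := phi \o f \o tau.

Definition local_map_dom (f : G -> G) : set 'rV[R]_n :=
  target phi `&` tau @^-1` (f @^-1` source phi).

Lemma local_map_dom_open f : continuous f -> open (local_map_dom f).
Proof.
move=> fc; rewrite openE => x [tx sx]; rewrite /interior /=.
have c : f (tau y) @[y --> x] --> f (tau x) := cvg_comp _ _ (cinv_cvg tx) (fc _).
near=> y; split.
- by near: y; exact: target_nbhs.
- by near: y; exact: c _ (source_nbhs sx).
Unshelve. all: by end_near. Qed.

Lemma local_map_dom_unit f : f 1%g = 1%g -> local_map_dom f e0.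
Proof. by move=> f1; split; rewrite //= tau_e f1. Qed.

Lemma local_map_unit f : f 1%g = 1%g -> local_map f e0 = e0.
Proof. by move=> f1; rewrite /local_map /= tau_e f1. Qed.

Lemma local_map_smooth f : smooth_map f ->
  smooth_on (local_map_dom f) (local_map f).
Proof. by move=> [_ sf]; apply: sf; exact: chart_at_atlas. Qed.

Lemma tangent_map1_local (u : lie_algebra G) :
  tangent_map1 B u = 'd (local_map B) e0 u.
Proof. by rewrite /tangent_map1 /tangent_map B1. Qed.

Let inv := local_map (fun g => g^-1)%g.

Lemma local_mul_inverse : \forall x \near e0, local_mul (x, inv x) = e0.
Proof.
have near_s : \forall g \near (1%g : G), source phi g by exact: source_nbhs.
have ci := invg_cvg tau_cvg; rewrite invg1 in ci.
have si : \forall x \near e0, source phi (tau x)^-1%g.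
  exact: ci _ near_s.
by apply: filterS si => x sx; rewrite /local_mul /inv /local_map /= cmapK// mulgV.
Qed.

(** Every product occurring in the identity tends to [1], hence lies in the
    domain of the chart, where the chart can be cancelled with its inverse. *)
Lemma local_rota_baxter : \forall z \near (e0, e0),
  let b := local_map B in
  local_mul (b z.1, b z.2) =
  b (local_mul (z.1, local_mul (local_mul (b z.1, z.2), inv (b z.1)))).
Proof.
have near_s : \forall g \near (1%g : G), source phi g by exact: source_nbhs.
have [[Bcont _] rb] := hB.
have c1 : tau z.1 @[z --> (e0, e0)] --> (1%g : G).
  exact: (cvg_comp _ _ cvg_fst tau_cvg).
have c2 : tau z.2 @[z --> (e0, e0)] --> (1%g : G).
  exact: (cvg_comp _ _ cvg_snd tau_cvg).
have cB1 : B (tau z.1) @[z --> (e0, e0)] --> (1%g : G).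
  by rewrite -[X in _ --> X]B1; exact: (cvg_comp _ _ c1 (Bcont _)).
have cB2 : B (tau z.2) @[z --> (e0, e0)] --> (1%g : G).
  by rewrite -[X in _ --> X]B1; exact: (cvg_comp _ _ c2 (Bcont _)).
have cV : (B (tau z.1))^-1%g @[z --> (e0, e0)] --> (1%g : G).
  by have := invg_cvg cB1; rewrite invg1; apply.
have cBy : (B (tau z.1) * tau z.2)%g @[z --> (e0, e0)] --> (1%g : G).
  by have := mulg_cvg cB1 c2; rewrite mulg1; apply.
have cAd : (B (tau z.1) * tau z.2 * (B (tau z.1))^-1)%g @[z --> (e0, e0)]
    --> (1%g : G).
  by have := mulg_cvg cBy cV; rewrite mulg1; apply.
have cx : (tau z.1 * (B (tau z.1) * tau z.2 * (B (tau z.1))^-1))%g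
    @[z --> (e0, e0)] --> (1%g : G).
  by have := mulg_cvg c1 cAd; rewrite mulg1; apply.
have nB1 : \forall z \near (e0, e0), source phi (B (tau z.1)).
  exact: cB1 _ near_s.
have nB2 : \forall z \near (e0, e0), source phi (B (tau z.2)).
  exact: cB2 _ near_s.
have nV : \forall z \near (e0, e0), source phi (B (tau z.1))^-1%g.
  exact: cV _ near_s.
have nBy : \forall z \near (e0, e0), source phi (B (tau z.1) * tau z.2)%g.
  exact: cBy _ near_s.
have nAd : \forall z \near (e0, e0),
  source phi (B (tau z.1) * tau z.2 * (B (tau z.1))^-1)%g.
  exact: cAd _ near_s.
have nx : \forall z \near (e0, e0),
  source phi (tau z.1 * (B (tau z.1) * tau z.2 * (B (tau z.1))^-1))%g.
  exact: cx _ near_s.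
near=> z; rewrite /= /local_mul /inv /local_map /=.
have sB1 : source phi (B (tau z.1)) by near: z.
have sB2 : source phi (B (tau z.2)) by near: z.
have sV : source phi (B (tau z.1))^-1%g by near: z.
have sBy : source phi (B (tau z.1) * tau z.2)%g by near: z.
have sAd : source phi (B (tau z.1) * tau z.2 * (B (tau z.1))^-1)%g by near: z.
have sx : source phi (tau z.1 * (B (tau z.1) * tau z.2 * (B (tau z.1))^-1))%g.
  by near: z.
rewrite (cmapK sB1) (cmapK sB2) (cmapK sV) (cmapK sBy) (cmapK sAd) (cmapK sx).
by rewrite rb.
Unshelve. all: by end_near. Qed.

Lemma lie_bracket_rota_baxter (u v : lie_algebra G) :
  local_bracket local_mul e0 ('d (local_map B) e0 u) ('d (local_map B) e0 v) =
  'd (local_map B) e0 (local_bracket local_mul e0 ('d (local_map B) e0 u) v) +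
  'd (local_map B) e0 (local_bracket local_mul e0 u ('d (local_map B) e0 v)) +
  'd (local_map B) e0 (local_bracket local_mul e0 u v).
Proof.
have inv_diff : differentiable inv e0.
  have smooth_inv := local_map_smooth (@invg_smooth R n G).
  exact: smooth_on_diff smooth_inv (local_map_dom_unit (invg1 _)).
exact: (local_bracket_rota_baxter local_mul_group
  (local_map_dom_open hB.1.1) (local_map_dom_unit B1) (local_map_smooth hB.1)
  (local_map_unit B1) inv_diff (local_map_unit (invg1 _)) local_mul_inverse
  local_rota_baxter).
Qed.
End RotaBaxterOperator.
End LieGroupLocal.

Theorem theorem2p10 (R : realType) (n : nat) (G : lieGroupType R n)
    (B : G -> G) (hB : rota_baxter_lie_group B) :
  rota_baxter_lie_algebra 1 (@lie_bracket R n G) (tangent_map1 B).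
Proof.
have -> : @lie_bracket R n G =
    local_bracket (local_mul G) (chart_at (1%g : G) 1%g).
  by apply/funext => u; apply/funext => v; exact: lie_bracket_local.
have -> : tangent_map1 B = 'd (local_map B) (chart_at (1%g : G) 1%g).
  by apply/funext => u; exact: tangent_map1_local.
split.
- exact: local_bracket_lie (local_mul_group G).
- exact: linearP.
- by move=> u v; rewrite scale1r; exact: lie_bracket_rota_baxter.
Qed.
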